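(* Let $P \subseteq [0,1]^n$ be a solvable convex body, let $G\colon [0,1]^n \to \mathbb{R}$ be a non-negative, monotone, $L$-smooth DR-submodular function, let $C\colon [0,1]^n \to \mathbb{R}$ be an $L$-smooth concave function, and let $F = G + C$. Let $\mathbf{o} \in \arg\max_{\mathbf{x}\in P} F(\mathbf{x})$, $D = \max_{\mathbf{x}\in P}\|\mathbf{x}\|_2$, let $\eta\ge 0$, and let $\varepsilon \in (0,1)$ be such that $\varepsilon^{-3}$ is an integer. Let $S_1$ be the time it takes to find a point in $P$ maximizing a given linear function, and let $S_2$ be the time it takes to find a point in $P$ maximizing $C(\cdot)$ up to an error of $\eta$. Then the algorithm Gradient Combining Frank-Wolfe (defined in the context) with parameter $\varepsilon$ runs in $O(\varepsilon^{-3}\cdot(n+S_1)+S_2)$ time, makes $O(1/\varepsilon^3)$ gradient oracle calls (to the gradient oracles of $G$ and $C$), and outputs a vector $\mathbf{y}$ such that $$F(\mathbf{y}) \ge \tfrac12(1-\varepsilon)\cdot G(\mathbf{o}) + C(\mathbf{o}) - \varepsilon\cdot O(\eta + L D^2).$$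
   Context: Inequalities between vectors hold coordinate-wise; $\langle\cdot,\cdot\rangle$ is the standard Euclidean inner product; $\mathbf{e}_i$ is the $i$-th standard basis vector. A function $G\colon[0,1]^n\to\mathbb{R}$ is DR-submodular if for all $\mathbf{a},\mathbf{b}\in[0,1]^n$ with $\mathbf{a}\le\mathbf{b}$, every $k>0$ and every $i\in\{1,\dots,n\}$ with $\mathbf{a}+k\mathbf{e}_i,\mathbf{b}+k\mathbf{e}_i\in[0,1]^n$, one has $G(\mathbf{a}+k\mathbf{e}_i)-G(\mathbf{a})\ge G(\mathbf{b}+k\mathbf{e}_i)-G(\mathbf{b})$. A function $f$ is $L$-smooth if it is differentiable and $\|\nabla f(\mathbf{a})-\nabla f(\mathbf{b})\|_2\le L\|\mathbf{a}-\mathbf{b}\|_2$ for all $\mathbf{a},\mathbf{b}\in[0,1]^n$. A function $f$ is monotone if $\mathbf{a}\le\mathbf{b}$ implies $f(\mathbf{a})\le f(\mathbf{b})$. $P$ is solvable if one can efficiently optimize linear functions over it. $O(\cdot)$ hides universal constants; oracle calls are counted separately from the running time. Algorithm Gradient Combining Frank-Wolfe ($\varepsilon$): let $\mathbf{y}^{(0)}$ be a vector in $P$ maximizing $C$ up to an error of $\eta$, i.e. $C(\mathbf{y}^{(0)})\ge\max_{\mathbf{x}\in P}C(\mathbf{x})-\eta$. For $i=1,\dots,\varepsilon^{-3}$: let $\mathbf{s}^{(i)}\in\arg\max_{\mathbf{x}\in P}\langle\nabla G(\mathbf{y}^{(i-1)})+2\nabla C(\mathbf{y}^{(i-1)}),\mathbf{x}\rangle$;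 set $\mathbf{y}^{(i)}\gets(1-\varepsilon^2)\cdot\mathbf{y}^{(i-1)}+\varepsilon^2\cdot\mathbf{s}^{(i)}$. Return the vector maximizing $F$ among $\{\mathbf{y}^{(0)},\dots,\mathbf{y}^{(\varepsilon^{-3})}\}$. *)

(* Defs.v *)
From mathcomp Require Import all_boot all_order all_algebra.
From mathcomp Require Import all_classical all_reals all_analysis.

Set Implicit Arguments.
Unset Strict Implicit.
Unset Printing Implicit Defensive.

Import Order.TTheory GRing.Theory Num.Theory.
Import numFieldNormedType.Exports.

Local Open Scope classical_set_scope.
Local Open Scope ring_scope.

(* Vectors are row vectors 'rV[R]_n.  The library norm on 'rV[R]_n is the sup
   norm, hence the Euclidean one below; the topologies coincide.  A function on
   [0,1]^n is a total function on 'rV[R]_n all of whose properties are required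
   on the cube only. *)

Definition dotv (R : realType) (n : nat) (u v : 'rV[R]_n) : R :=
  \sum_i u 0 i * v 0 i.

Definition norm2 (R : realType) (n : nat) (u : 'rV[R]_n) : R :=
  Num.sqrt (dotv u u).

Definition lev (R : realType) (n : nat) (u v : 'rV[R]_n) : Prop :=
  forall i, u 0 i <= v 0 i.

Definition cube (R : realType) (n : nat) : set 'rV[R]_n :=
  [set x | forall i, 0 <= x 0 i <= 1].
Arguments cube {R n}.

Definition nonnegative (R : realType) (n : nat) (f : 'rV[R]_n -> R) : Prop :=
  forall a, cube a -> 0 <= f a.

Definition monotone_fun (R : realType) (n : nat) (f : 'rV[R]_n -> R) : Prop :=
  forall a b, cube a -> cube b -> lev a b -> f a <= f b.

Definition DR_submodular (R : realType) (n : nat) (f : 'rV[R]_n -> R) : Prop :=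
  forall (a b : 'rV[R]_n) (k : R) (i : 'I_n),
    cube a -> cube b -> lev a b -> 0 < k ->
    cube (a + k *: 'e_i) -> cube (b + k *: 'e_i) ->
    f (b + k *: 'e_i) - f b <= f (a + k *: 'e_i) - f a.

Definition concave (R : realType) (n : nat) (f : 'rV[R]_n -> R) : Prop :=
  convex_function (@cube R n) (fun x => - f x).

(* Differentiability relative to the cube, so that it makes sense on its
   boundary: f x = f a + <g, x - a> + o(x - a) as x tends to a in the cube.
   Such a g is unique when a is in the cube. *)
Definition is_grad (R : realType) (n : nat) (f : 'rV[R]_n -> R)
    (a g : 'rV[R]_n) : Prop :=
  forall e : R, 0 < e ->
    \forall x \near a, cube x ->
      `|f x - f a - dotv g (x - a)| <= e * norm2 (x - a).

(* The value is 0 where f is not differentiable. *)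
Definition grad (R : realType) (n : nat) (f : 'rV[R]_n -> R) (a : 'rV[R]_n) :
  'rV[R]_n := xget 0 [set g | is_grad f a g].

Definition smooth (R : realType) (n : nat) (L : R) (f : 'rV[R]_n -> R) : Prop :=
  (forall a, cube a -> exists g, is_grad f a g) /\
  (forall a b, cube a -> cube b ->
     norm2 (grad f a - grad f b) <= L * norm2 (a - b)).

(* A nonempty interior is not required, so lower-dimensional bodies qualify. *)
Definition convex_body (R : realType) (n : nat) (P : set 'rV[R]_n) : Prop :=
  [/\ P !=set0, compact P & convex_set P].

Definition argmax (R : realType) (T : Type) (P : set T) (f : T -> R) : set T :=
  [set x | P x /\ forall z, P z -> f z <= f x].

Definition approx_argmax (R : realType) (T : Type) (eta : R) (P : set T)
    (f : T -> R) : set T :=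
  [set x | P x /\ forall z, P z -> f z - eta <= f x].

(* A real-RAM with oracles: memory consists of numbered index registers (nat), scalar registers (R) and
   vector registers ('rV[R]_n); vectors are only accessible one coordinate at a
   time, or as arguments and results of oracles. *)

Record state (R : realType) (n : nat) := State {
  idx : nat -> nat;
  scal : nat -> R;
  vec : nat -> 'rV[R]_n }.

Definition upd (T : Type) (f : nat -> T) (r : nat) (v : T) : nat -> T :=
  fun r' => if r' == r then v else f r'.

Definition read (R : realType) (n : nat) (x : 'rV[R]_n) (k : nat) : R :=
  if (insub k : option 'I_n) is Some j then x 0 j else 0.

Definition write (R : realType) (n : nat) (x : 'rV[R]_n) (k : nat) (a : R) :
  'rV[R]_n := \row_j (if (j : nat) == k then a else x 0 j).

Definition set_idx (R : realType) (n : nat) (st : state R n) r k :=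
  State (upd (idx st) r k) (scal st) (vec st).

Definition set_scal (R : realType) (n : nat) (st : state R n) r a :=
  State (idx st) (upd (scal st) r a) (vec st).

Definition set_vec (R : realType) (n : nat) (st : state R n) r x :=
  State (idx st) (scal st) (upd (vec st) r x).

(* Coord v i is the coordinate of vector register v whose number is the content
   of index register i. *)
Inductive expr (R : realType) :=
| Const (a : R)
| Scal (r : nat)
| Coord (v i : nat)
| Add (e1 e2 : expr R)
| Sub (e1 e2 : expr R)
| Mul (e1 e2 : expr R).

Fixpoint eval (R : realType) (n : nat) (st : state R n) (e : expr R) : R :=
  match e with
  | Const a => a
  | Scal r => scal st r
  | Coord v i => read (vec st v) (idx st i)
  | Add e1 e2 => eval st e1 + eval st e2
  | Sub e1 e2 => eval st e1 - eval st e2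
  | Mul e1 e2 => eval st e1 * eval st e2
  end.

Fixpoint ecost (R : realType) (e : expr R) : nat :=
  match e with
  | Const _ | Scal _ | Coord _ _ => 1
  | Add e1 e2 | Sub e1 e2 | Mul e1 e2 => (1 + ecost e1 + ecost e2)%N
  end.

(* For i a b c runs c with index register i equal to a, ..., b - 1.
   In the oracle calls, v is the register holding the query point and the last
   argument is the destination register. *)
Inductive cmd (R : realType) :=
| SetScal (r : nat) (e : expr R)
| SetCoord (v i : nat) (e : expr R)
| Seq (c1 c2 : cmd R)
| IfLt (e1 e2 : expr R) (c : cmd R)
| For (i a b : nat) (c : cmd R)
| ValG (v r : nat)
| ValC (v r : nat)
| GradG (v w : nat)
| GradC (v w : nat)
| LinMax (v w : nat)
| MaxC (w : nat).

Record oracles (R : realType) (n : nat) := Oracles {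
  valG : 'rV[R]_n -> R;
  valC : 'rV[R]_n -> R;
  gradG : 'rV[R]_n -> 'rV[R]_n;
  gradC : 'rV[R]_n -> 'rV[R]_n;
  linmax : 'rV[R]_n -> set 'rV[R]_n;
  maxC : set 'rV[R]_n;
  time_linmax : nat;
  time_maxC : nat }.

(* exec O c st st' t q: from st, command c may end in st', in t time units and
   with q gradient oracle calls (to G and C together).  Every instruction takes
   one time unit, on top of which come the evaluation of its expressions and,
   for LinMax and MaxC, the time of that subroutine.  The work done inside the
   value and gradient oracles is not part of the running time.  LinMax and MaxC
   may return any admissible answer. *)
Inductive exec (R : realType) (n : nat) (O : oracles R n) :
  cmd R -> state R n -> state R n -> nat -> nat -> Prop :=
| exec_SetScal st r e :
    exec O (SetScal r e) st (set_scal st r (eval st e)) (1 + ecost e) 0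
| exec_SetCoord st v i e :
    exec O (SetCoord v i e) st
      (set_vec st v (write (vec st v) (idx st i) (eval st e))) (1 + ecost e) 0
| exec_Seq st st1 st2 c1 c2 t1 t2 q1 q2 :
    exec O c1 st st1 t1 q1 -> exec O c2 st1 st2 t2 q2 ->
    exec O (Seq c1 c2) st st2 (t1 + t2) (q1 + q2)
| exec_IfLt_true st st1 e1 e2 c t q :
    eval st e1 < eval st e2 -> exec O c st st1 t q ->
    exec O (IfLt e1 e2 c) st st1 (1 + ecost e1 + ecost e2 + t) q
| exec_IfLt_false st e1 e2 c :
    eval st e2 <= eval st e1 ->
    exec O (IfLt e1 e2 c) st st (1 + ecost e1 + ecost e2) 0
| exec_For_end st i a b c :
    (b <= a)%N -> exec O (For i a b c) st st 1 0
| exec_For_step st st1 st2 i a b c t1 t2 q1 q2 :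
    (a < b)%N -> exec O c (set_idx st i a) st1 t1 q1 ->
    exec O (For i a.+1 b c) st1 st2 t2 q2 ->
    exec O (For i a b c) st st2 (1 + t1 + t2) (q1 + q2)
| exec_ValG st v r :
    exec O (ValG R v r) st (set_scal st r (valG O (vec st v))) 1 0
| exec_ValC st v r :
    exec O (ValC R v r) st (set_scal st r (valC O (vec st v))) 1 0
| exec_GradG st v w :
    exec O (GradG R v w) st (set_vec st w (gradG O (vec st v))) 1 1
| exec_GradC st v w :
    exec O (GradC R v w) st (set_vec st w (gradC O (vec st v))) 1 1
| exec_LinMax st v w x :
    linmax O (vec st v) x ->
    exec O (LinMax R v w) st (set_vec st w x) (1 + time_linmax O) 0
| exec_MaxC st w x :
    maxC O x ->
    exec O (MaxC R w) st (set_vec st w x) (1 + time_maxC O) 0.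

Notation "c1 ;; c2" := (Seq c1 c2) (at level 90, right associativity).

Definition v_y := 0%N.
Definition v_g := 1%N.
Definition v_h := 2%N.
Definition v_w := 3%N.
Definition v_s := 4%N.
Definition v_best := 5%N.

Definition r_g := 0%N.
Definition r_c := 1%N.
Definition r_F := 2%N.
Definition r_best := 3%N.

Definition i_iter := 0%N.
Definition i_coord := 1%N.

Definition eval_F (R : realType) : cmd R :=
  ValG R v_y r_g ;; ValC R v_y r_c ;;
  SetScal r_F (Add (Scal R r_g) (Scal R r_c)).

Definition save_best (R : realType) (n : nat) : cmd R :=
  SetScal r_best (Scal R r_F) ;;
  For i_coord 0 n (SetCoord v_best i_coord (Coord R v_y i_coord)).

(* eps^{-3} is assumed to be an integer, so truncn does not round.  The iterate
   of largest F seen so far is maintained in v_best, which holds the output. *)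
Definition gradient_combining_FW (R : realType) (n : nat) (eps : R) : cmd R :=
  let eps2 := Mul (Const eps) (Const eps) in
  MaxC R v_y ;;
  eval_F R ;;
  save_best R n ;;
  For i_iter 1 (Num.truncn (eps ^- 3)).+1 (
    GradG R v_y v_g ;;
    GradC R v_y v_h ;;
    For i_coord 0 n
      (SetCoord v_w i_coord
         (Add (Coord R v_g i_coord)
              (Mul (Const 2) (Coord R v_h i_coord)))) ;;
    LinMax R v_w v_s ;;
    For i_coord 0 n
      (SetCoord v_y i_coord
         (Add (Mul (Sub (Const 1) eps2) (Coord R v_y i_coord))
              (Mul eps2 (Coord R v_s i_coord)))) ;;
    eval_F R ;;
    IfLt (Scal R r_best) (Scal R r_F) (save_best R n)).

Definition output (R : realType) (n : nat) (st : state R n) : 'rV[R]_n :=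
  vec st v_best.

(* The oracles of an instance (P, G, C); S1 and S2 are the times of linear
   maximization over P and of maximizing C over P up to eta. *)
Definition oracles_of (R : realType) (n : nat) (P : set 'rV[R]_n)
    (G C : 'rV[R]_n -> R) (eta : R) (S1 S2 : nat) : oracles R n :=
  {| valG := G; valC := C; gradG := grad G; gradC := grad C;
     linmax := fun w => argmax P (dotv w);
     maxC := approx_argmax eta P C;
     time_linmax := S1; time_maxC := S2 |}.

(* Main.v *)
Require Import Defs.
From mathcomp Require Import all_boot all_order all_algebra.
From mathcomp Require Import all_classical all_reals all_analysis.
From mathcomp Require Import ring lra zify.

(** The potential Phi = G + 2 C is what one step of the algorithm increases.
At a point y of the cube, monotone DR-submodularity and concavity give
  <grad G y, o - y> >= G o - 2 G y     and     <grad C y, o - y> >= C o - C y,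
so the direction s - y, which is at least as good as o - y for
grad G y + 2 grad C y, has slope at least G o + 2 C o - 2 F y for Phi: the
weights 1 and 2 are those for which the loss terms combine into F.  A step of
length eps ^ 2 gains eps ^ 2 times this slope, up to a second-order error
6 L D ^ 2 eps ^ 4 coming from smoothness ([FW_step_progress]).

Replacing F y by the best value F b seen so far and adding the eps ^ -3 steps,
the total gain is at least
  eps ^ -1 (G o + 2 C o - 2 F b) - 6 L D ^ 2 eps.
On the other hand the total gain is at most G o + 2 eta: F of the last iterate
is at most F o, and both C o and C of the last iterate exceed C y0 by at most
eta ([FW_invariant_bound]).  Comparing the two and multiplying by eps / 2 gives
the approximation guarantee.

The inequality for G only uses that G is concave along directions all of whose
coordinates have the same sign ([DR_submodular_le_grad_up] and
[DR_submodular_le_grad_down]); it is applied to the positive and to the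
negative part of o - y.

The statement about executions is obtained with a weakest-precondition calculus
[wp], which asserts both that a command has an execution and that all its
executions satisfy a postcondition on the final state, the time and the number
of gradient calls.  Executions exist because linear functions and C are
continuous on the compact set P. *)

Set Implicit Arguments.
Unset Strict Implicit.
Unset Printing Implicit Defensive.

Import Order.TTheory GRing.Theory Num.Theory.
Import numFieldNormedType.Exports.

Local Open Scope classical_set_scope.
Local Open Scope ring_scope.

(** * Euclidean inner product and norm *)

Section Dot.
Context {R : realType} {n : nat}.
Implicit Types (u v w : 'rV[R]_n) (a : R).

Lemma dotvC u v : dotv u v = dotv v u.
Proof. by apply: eq_bigr => i _; rewrite mulrC. Qed.

Lemma dotvDr u v w : dotv u (v + w) = dotv u v + dotv u w.
Proof. by rewrite -big_split; apply: eq_bigr => i _; rewrite mxE mulrDr. Qed.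

Lemma dotvZr a u v : dotv u (a *: v) = a * dotv u v.
Proof. by rewrite mulr_sumr; apply: eq_bigr => i _; rewrite mxE mulrCA. Qed.

Lemma dotvNr u v : dotv u (- v) = - dotv u v.
Proof. by rewrite -scaleN1r dotvZr mulN1r. Qed.

Lemma dotvBr u v w : dotv u (v - w) = dotv u v - dotv u w.
Proof. by rewrite dotvDr dotvNr. Qed.

Lemma dotvDl u v w : dotv (u + v) w = dotv u w + dotv v w.
Proof. by rewrite dotvC dotvDr !(dotvC w). Qed.

Lemma dotvZl a u v : dotv (a *: u) v = a * dotv u v.
Proof. by rewrite dotvC dotvZr dotvC. Qed.

Lemma dotvBl u v w : dotv (u - v) w = dotv u w - dotv v w.
Proof. by rewrite dotvC dotvBr !(dotvC w). Qed.

Lemma dotvv_ge0 u : 0 <= dotv u u.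
Proof. by apply: sumr_ge0 => i _; rewrite -expr2 sqr_ge0. Qed.

Lemma norm2_sqr u : norm2 u ^+ 2 = dotv u u.
Proof. by rewrite sqr_sqrtr // dotvv_ge0. Qed.

Lemma norm2_ge0 u : 0 <= norm2 u. Proof. exact: sqrtr_ge0. Qed.

Lemma norm2Z a u : norm2 (a *: u) = `|a| * norm2 u.
Proof.
by rewrite /norm2 dotvZl dotvZr mulrA -expr2 sqrtrM ?sqr_ge0// sqrtr_sqr.
Qed.

(** The squared norm of [<v, v> u - <u, v> v] is [<v, v>] times the difference
of the two sides. *)
Lemma dotv_sqr_le u v : dotv u v ^+ 2 <= dotv u u * dotv v v.
Proof.
have [v0|vn0] := eqVneq (dotv v v) 0.
  have -> : dotv u v = 0.
    have v00 i : v 0 i = 0.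
      have /eqP := v0; rewrite psumr_eq0 => [/allP/(_ i)|j _]; last first.
        by rewrite -expr2 sqr_ge0.
      by rewrite mem_index_enum mulf_eq0 orbb => /(_ isT)/eqP.
    by rewrite /dotv big1 // => i _; rewrite v00 mulr0.
  by rewrite v0 expr0n mulr0.
have v_gt0 : 0 < dotv v v by rewrite lt_neqAle eq_sym vn0 dotvv_ge0.
have := dotvv_ge0 (dotv v v *: u - dotv u v *: v).
rewrite !(dotvBl, dotvBr, dotvZl, dotvZr) (dotvC v u).
set x := dotv u u; set y := dotv u v; set z := dotv v v in v_gt0 *.
rewrite [X in 0 <= X](_ : _ = z * (x * z - y ^+ 2)); last by ring.
by rewrite pmulr_rge0 // subr_ge0.
Qed.

Lemma cauchy_schwarz u v : `|dotv u v| <= norm2 u * norm2 v.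
Proof.
rewrite -sqrtrM ?dotvv_ge0 // -sqrtr_sqr ler_sqrt ?dotv_sqr_le //.
by rewrite mulr_ge0 ?dotvv_ge0.
Qed.

Lemma dotv_continuous u : continuous (dotv u).
Proof.
apply: continuous_big => [|i _ x]; first exact: add_continuous.
by apply: continuousM; [exact: cst_continuous|exact: coord_continuous].
Qed.

Lemma norm2B_continuous (x0 : 'rV[R]_n) : continuous (fun x : 'rV[R]_n => norm2 (x - x0) : R).
Proof.
move=> x.
apply: (@continuous_comp _ _ _ (fun x : 'rV[R]_n => dotv (x - x0) (x - x0)) Num.sqrt).
  apply: continuous_big => [|i _ y]; first exact: add_continuous.
  have c1 : {for y, continuous (fun z : 'rV[R]_n => (z - x0) 0 i : R)}.
    rewrite (_ : (fun _ => _) = (fun z : 'rV[R]_n => z 0 i - x0 0 i)); last first.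
      by apply/funext => z; rewrite !mxE.
    by apply: continuousB; [exact: coord_continuous|exact: cst_continuous].
  exact: continuousM.
exact: sqrt_continuous.
Qed.

Lemma near_norm2B (x0 : 'rV[R]_n) (e : R) : 0 < e ->
  \forall x \near x0, norm2 (x - x0) <= e.
Proof.
move=> e0; have h0 : norm2 (x0 - x0) = 0.
  by rewrite subrr -(scale0r (0 : 'rV[R]_n)) norm2Z normr0 mul0r.
have /cvgrPdist_le/(_ e e0) := @norm2B_continuous x0 x0.
apply: filterS => x; rewrite h0.
by rewrite sub0r normrN ger0_norm ?norm2_ge0.
Qed.
End Dot.

(** * Gradients relative to the cube *)

Section Cube.
Context {R : realType} {n : nat}.
Implicit Types (a b d : 'rV[R]_n).

Lemma cube_between a b x : cube a -> cube b -> lev a x -> lev x b -> cube x.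
Proof.
move=> ca cb ax xb i; have /andP[a0 _] := ca i; have /andP[_ b1] := cb i.
by rewrite (le_trans a0 (ax i)) (le_trans (xb i) b1).
Qed.

Lemma cube_segment a d t : cube a -> cube (a + d) -> 0 <= t <= 1 ->
  cube (a + t *: d).
Proof.
move=> ca cb /andP[t0 t1] i; have := ca i; have := cb i.
rewrite !mxE; move: (a 0 i) (d 0 i) => x y; nra.
Qed.
End Cube.

Section FirstOrder.
Context {R : realType} {n : nat}.
Implicit Types (f : 'rV[R]_n -> R) (a d g : 'rV[R]_n) (e t : R).

Lemma segment_continuous a d : continuous (fun t : R => a + t *: d).
Proof.
move=> t; apply: cvgD; first exact: cvg_cst.
exact: scalel_continuous.
Qed.

(** The slope of f along a segment is the inner product of the gradient with its
direction; all estimates below are one-dimensional through this lemma. *)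
Lemma is_grad_line f a d g t e : is_grad f (a + t *: d) g -> 0 < e ->
  \forall s \near t, cube (a + s *: d) ->
    `|f (a + s *: d) - f (a + t *: d) - (s - t) * dotv g d| <= e * `|s - t|.
Proof.
move=> fg e0; have D0 : 0 < 1 + norm2 d by rewrite ltr_pwDl // norm2_ge0.
have H : \forall s \near t, cube (a + s *: d) ->
    `|f (a + s *: d) - f (a + t *: d) - dotv g (a + s *: d - (a + t *: d))|
      <= e / (1 + norm2 d) * norm2 (a + s *: d - (a + t *: d)).
  exact: (@segment_continuous a d t _ (fg _ (divr_gt0 e0 D0))).
apply: filterS H => s H /H.
rewrite opprD addrACA subrr add0r -scalerBl dotvZr => /le_trans; apply.
rewrite norm2Z [_ * norm2 d]mulrC mulrA ler_wpM2r //.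
by rewrite mulrAC ler_pdivrMr // ler_wpM2l ?lerDr // ltW.
Qed.

Lemma is_grad_continuous f a g : is_grad f a g ->
  f @ within cube (nbhs a) --> f a.
Proof.
move=> fg; apply/cvgrPdist_le => e e0.
have D0 : 0 < norm2 g + 1 by rewrite ltr_wpDl // norm2_ge0.
rewrite near_withinE; near=> x => cx.
have H1 : `|f x - f a - dotv g (x - a)| <= 1 * norm2 (x - a).
  by move: cx; near: x; exact: fg.
have H2 : norm2 (x - a) <= e / (norm2 g + 1).
  by near: x; apply: near_norm2B; rewrite divr_gt0.
rewrite ler_pdivlMr // mulrC in H2.
have H3 := cauchy_schwarz g (x - a).
rewrite distrC; apply: le_trans H2.
rewrite -[f x - f a](subrK (dotv g (x - a))).
rewrite (le_trans (ler_normD _ _)) // mulrDl addrC lerD //.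
Unshelve. all: by end_near. Qed.

(** The secant slopes of a function that is concave along a segment dominate its
total slope, and those over shorter and shorter initial pieces tend to the
derivative.  The pieces of length 1 / (m + 1) are enough, and they are the ones
that DR-submodularity controls without any continuity. *)
Lemma secants_le_grad f a d g : is_grad f a g -> cube a -> cube (a + d) ->
  (forall m : nat,
    m.+1%:R^-1 * (f (a + d) - f a) <= f (a + m.+1%:R^-1 *: d) - f a) ->
  f (a + d) - f a <= dotv g d.
Proof.
move=> fg ca cad H; apply/ler_addgt0Pr => e e0.
have fg0 : is_grad f (a + (0 : R) *: d) g by rewrite scale0r addr0.
have := is_grad_line fg0 e0 => /(@cvg_harmonic R)[N _ /(_ N (leqnn N))] /=.
have t0 : 0 < (N.+1%:R^-1 : R) by rewrite invr_gt0.
have := H N; rewrite scale0r addr0 subr0; set t := N.+1%:R^-1 in t0 *.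
have t1 : t <= 1 by rewrite invf_le1 ?ler1n.
move=> Ht /(_ _); rewrite (gtr0_norm t0) => /(_ _)Hs.
have /Hs : cube (a + t *: d) by apply: cube_segment; rewrite ?(ltW t0).
rewrite ler_norml => /andP[_ h].
rewrite -(ler_pM2l t0) (le_trans Ht) // mulrDr; lra.
Qed.

Lemma grad_is_grad L f a : smooth L f -> cube a -> is_grad f a (grad f a).
Proof.
by move=> [fd _] /fd fa; rewrite /grad; exact: (@xgetPex _ 0 [set g | is_grad f a g]).
Qed.

Lemma smooth_within_continuous L f (P : set 'rV[R]_n) :
  smooth L f -> P `<=` cube -> {within P, continuous f}.
Proof.
move=> sf PQ; apply/subspace_continuousP => a Pa.
have := is_grad_continuous (grad_is_grad sf (PQ _ Pa)).
by apply: cvg_trans; apply: cvg_app; apply: within_subset => //; exact: filter_near_of.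
Qed.
End FirstOrder.

(** The mean value theorem on the segment from a to b; at the intermediate point
the gradient differs from that at a by at most L |b - a|.  Integrating along the
segment would give L / 2, but only the order of the error matters here. *)
Lemma smooth_lower_bound (R : realType) (n : nat) (L : R) (f : 'rV[R]_n -> R)
    (a b : 'rV[R]_n) : smooth L f -> cube a -> cube b ->
  dotv (grad f a) (b - a) - L * dotv (b - a) (b - a) <= f b - f a.
Proof.
move=> sf ca cb; set d := b - a.
have adE : a + d = b by rewrite addrC subrK.
have cad : cube (a + d) by rewrite adE.
pose phi (t : R) := f (a + t *: d).
have cseg (t : R) : 0 <= t <= 1 -> cube (a + t *: d) by exact: cube_segment.
have gseg (t : R) : 0 <= t <= 1 -> is_grad f (a + t *: d) (grad f (a + t *: d)).
  by move/cseg; exact: grad_is_grad sf.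
have der (t : R) : t \in `]0, 1[%R ->
    is_derive t 1 phi (dotv (grad f (a + t *: d)) d).
  move=> t01; have tc : 0 <= t <= 1.
    by move: t01; rewrite in_itv /= => /andP[/ltW-> /ltW->].
  suff H : h^-1 *: (phi (h *: (1 : R^o) + t) - phi t) @[h --> 0^'] -->
      (dotv (grad f (a + t *: d)) d : R^o).
    by apply: DeriveDef; [exact: cvgP H|exact: cvg_lim H].
  apply/cvgrPdist_le => e e0.
  have near_t := is_grad_line (gseg _ tc) e0.
  have near_h : \forall h \near (0 : R), `|phi (h + t) - phi t -
       h * dotv (grad f (a + t *: d)) d| <= e * `|h|.
    have c0 : h + t @[h --> (0:R)] --> t.
      rewrite -[X in _ --> X]add0r.
      by apply: cvgD; [exact: cvg_id|exact: cvg_cst].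
    have in01 : \forall s \near t, s \in `]0, 1[%R by exact: near_in_itvoo.
    have near_h : \forall h \near (0 : R), (cube (a + (h + t) *: d) ->
        `|phi (h + t) - phi t - (h + t - t) * dotv (grad f (a + t *: d)) d|
          <= e * `|h + t - t|) /\ h + t \in `]0, 1[%R.
      exact: c0 _ (filterI near_t in01).
    apply: filterS near_h => h [].
    rewrite addrK => Hh; rewrite in_itv /= => /andP[/ltW h0 /ltW h1].
    by apply: Hh; apply: cseg; rewrite h0.
  rewrite near_withinE; apply: filterS near_h => h Hh h0.
  have hh : 0 < `|h| by rewrite normr_gt0.
  rewrite -(ler_pM2r hh) /= [h *: 1]mulr1 distrC.
  rewrite -normrM.
  rewrite (_ : (_ - _) * h = phi (h + t) - phi t
     - h * dotv (grad f (a + t *: d)) d) //.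
  by rewrite mulrBl -[_ *: _]/(_ * _) mulrAC mulVf // mul1r [in LHS](mulrC _ h).
have cont : {within `[0, 1], continuous phi}.
  apply/subspace_continuousP => t /=; rewrite in_itv /= => tc.
  have fc := is_grad_continuous (gseg _ tc).
  apply/cvgrPdist_le => e e0.
  move/cvgrPdist_le: fc => /(_ e e0); rewrite !near_withinE => near_a.
  have near_t : \forall s \near t, cube (a + s *: d) ->
      `|phi t - phi s| <= e.
    exact: (@segment_continuous _ _ a d t _ near_a).
  apply: filterS near_t => s Hs.
  by rewrite /= in_itv /= => s01; apply: Hs; exact: cseg.
have [c c01] := MVT ltr01 der cont.
rewrite /phi scale1r scale0r addr0 subr0 mulr1 adE => ->.
move: c01; rewrite in_itv /= => /andP[/ltW c0 /ltW c1].
have cc : cube (a + c *: d) by apply: cseg; rewrite c0.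
rewrite lerBlDr -lerBlDl -dotvBl.
apply: le_trans (ler_norm _) _; apply: le_trans (cauchy_schwarz _ _) _.
have := sf.2 _ _ ca cc.
rewrite opprD addrA subrr add0r -scaleNr norm2Z normrN ger0_norm // => H.
rewrite -norm2_sqr expr2 mulrA ler_wpM2r ?norm2_ge0 // (le_trans H) //.
have L0 : 0 <= L * norm2 d.
  by apply: le_trans (sf.2 _ _ cb ca); exact: norm2_ge0.
by rewrite mulrCA ler_piMl.
Qed.

Lemma concave_le_grad (R : realType) (n : nat) (L : R) (f : 'rV[R]_n -> R)
    (a b : 'rV[R]_n) : smooth L f -> concave f -> cube a -> cube b ->
  f b - f a <= dotv (grad f a) (b - a).
Proof.
move=> sf fc ca cb.
have ab : a + (b - a) = b by rewrite addrC subrK.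
rewrite -{1}ab; apply: secants_le_grad => //; rewrite ?ab //.
  exact: grad_is_grad sf ca.
move=> m; have t0 : 0 <= (m.+1%:R^-1 : R) by rewrite invr_ge0.
have t1 : (m.+1%:R^-1 : R) <= 1 by rewrite invf_le1 ?ler1n.
have t01 : 0 <= (m.+1%:R^-1 : R) <= 1 by rewrite t0.
have := fc (Itv01 t0 t1) b a; rewrite !inE => /(_ cb ca).
rewrite [X in - f X](_ : _ = a + m.+1%:R^-1 *: (b - a)); last first.
  by rewrite /conv /= /unstable.onem scalerBl scale1r scalerBr addrCA.
rewrite convRE /= /unstable.onem.
set t : R := m.+1%:R^-1; move: (f _) (f b) (f a) => z y x; lra.
Qed.

(** * First-order inequality for monotone DR-submodular functions *)

Section DR.
Context {R : realType} {n : nat} (G : 'rV[R]_n -> R).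
Hypothesis DR : DR_submodular G.
Implicit Types (a b u : 'rV[R]_n).

(** Diminishing returns extend from single coordinates to nonnegative vectors:
the coordinates of u are added one at a time. *)
Lemma DR_submodular_vec a b u : cube a -> cube (b + u) -> lev a b -> lev 0 u ->
  G (b + u) - G b <= G (a + u) - G a.
Proof.
move=> ca cbu ab u0.
(* p k is u with only its first k coordinates kept *)
pose p k : 'rV[R]_n := \row_j (if (j < k)%N then u 0 j else 0).
have p0 j k : 0 <= p k 0 j by have := u0 j; rewrite !mxE; case: ifP.
have pu j k : p k 0 j <= u 0 j by have := u0 j; rewrite !mxE; case: ifP.
have cp x k : lev a x -> lev x b -> cube (x + p k).
  move=> ax xb; apply: cube_between ca cbu _ _ => j; rewrite !mxE.
    by rewrite ler_wpDr //; have := p0 j k; rewrite mxE.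
  by rewrite lerD //; have := pu j k; rewrite mxE.
suff H k : (k <= n)%N -> G (b + p k) - G b <= G (a + p k) - G a.
  have <- : p n = u by apply/rowP => j; rewrite mxE ltn_ord.
  exact: H.
elim: k => [_|k IH kn].
  have -> : p 0%N = 0 by apply/rowP => j; rewrite !mxE.
  by rewrite !addr0 !subrr.
pose i := Ordinal kn.
have pS : p k.+1 = p k + u 0 i *: 'e_i.
  apply/rowP => j; rewrite !mxE eqxx /= ltnS leq_eqVlt -(inj_eq val_inj) /=.
  have [jk|] := eqVneq; last by case: ifP; rewrite mulr0 addr0.
  rewrite jk ltnn add0r mulr1; congr (u 0 _); exact: val_inj.
have {}IH := IH (ltnW kn).
suff : G (b + p k.+1) - G (b + p k) <= G (a + p k.+1) - G (a + p k) by lra.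
have := u0 i; rewrite mxE le_eqVlt => /predU1P[ui0|ui].
  by rewrite pS -ui0 scale0r addr0 !subrr.
have [aa bb] : lev a a /\ lev b b by split=> j.
rewrite pS !addrA; apply: DR => //; rewrite -?addrA -?pS; try exact: cp.
by move=> j; have := ab j; rewrite !mxE lerD2r.
Qed.

(** Cut the segment from a to a + u into m + 1 equal pieces: the increments of G
over them decrease, so their sum is at most m + 1 times the first one and at
least m + 1 times the last one. *)
Lemma DR_submodular_increments a u m : cube a -> cube (a + u) -> lev 0 u ->
  G (a + u) - G a <= m.+1%:R * (G (a + m.+1%:R^-1 *: u) - G a) /\
  m.+1%:R * (G (a + u) - G (a + u - m.+1%:R^-1 *: u)) <= G (a + u) - G a.
Proof.
move=> ca cau u0; set t : R := m.+1%:R^-1.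
have t_gt0 : 0 < t by rewrite invr_gt0.
have tm : m.+1%:R * t = 1 by rewrite mulfV.
pose q (k : nat) := a + (k%:R * t) *: u.
have qS k : q k.+1 = q k + t *: u.
  by rewrite /q -addrA -scalerDl -natr1 mulrDl mul1r.
have q0 : q 0%N = a by rewrite /q mul0r scale0r addr0.
have qm : q m.+1 = a + u by rewrite /q tm scale1r.
have cq k : (k <= m.+1)%N -> cube (q k).
  move=> km; apply: cube_segment => //; rewrite mulr_ge0 ?(ltW t_gt0) //=.
  by rewrite -[leRHS]tm ler_wpM2r ?ler_nat // ltW.
have qle k l : (k <= l)%N -> lev (q k) (q l).
  move=> kl i; have := u0 i; rewrite !mxE => ui.
  by rewrite lerD2l !ler_wpM2r ?ler_nat ?(ltW t_gt0).
have tu0 : lev 0 (t *: u).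
  by move=> i; have := u0 i; rewrite !mxE => ?; rewrite mulr_ge0 ?(ltW t_gt0).
have incr k l : (k <= l <= m)%N -> G (q l.+1) - G (q l) <= G (q k.+1) - G (q k).
  move=> /andP[kl lm]; rewrite !qS; apply: DR_submodular_vec => //.
  - by apply: cq; lia.
  - by rewrite -qS; apply: cq.
  - exact: qle.
have telescope : G (a + u) - G a = \sum_(0 <= k < m.+1) (G (q k.+1) - G (q k)).
  by rewrite (telescope_sumr (fun k => G (q k))) // q0 qm.
have const x : m.+1%:R * x = \sum_(0 <= k < m.+1) x.
  by rewrite sumr_const_nat subn0 mulr_natl.
have -> : a + u - t *: u = q m by rewrite -qm qS addrK.
have -> : a + t *: u = q 1%N by rewrite qS q0.
rewrite telescope !const; split; apply: ler_sum_nat => k /andP[_ km].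
  by rewrite -q0; apply: incr.
by rewrite -qm; apply: incr; rewrite leqnn andbT.
Qed.

Lemma DR_submodular_le_grad_up L a u : smooth L G ->
  cube a -> cube (a + u) -> lev 0 u -> G (a + u) - G a <= dotv (grad G a) u.
Proof.
move=> sG ca cau u0; apply: secants_le_grad => //; first exact: grad_is_grad sG ca.
move=> m; rewrite ler_pdivrMl //.
by have [] := DR_submodular_increments m ca cau u0.
Qed.

Lemma DR_submodular_le_grad_down L a u : smooth L G ->
  cube a -> cube (a - u) -> lev 0 u -> G (a - u) - G a <= dotv (grad G a) (- u).
Proof.
move=> sG ca cau u0; apply: secants_le_grad => //; first exact: grad_is_grad sG ca.
move=> m; rewrite ler_pdivrMl // scalerN.
have ca' : cube (a - u + u) by rewrite subrK.
have [_] := DR_submodular_increments m cau ca' u0; rewrite subrK; lra.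
Qed.
End DR.

(** Moving from y up to the join of y and o gains at least G o - G y by
monotonicity; moving down to their meet loses at most G y by nonnegativity. *)
Lemma monotone_DR_submodular_grad (R : realType) (n : nat) (L : R)
    (G : 'rV[R]_n -> R) (y o : 'rV[R]_n) :
  nonnegative G -> monotone_fun G -> DR_submodular G -> smooth L G ->
  cube y -> cube o -> G o - 2 * G y <= dotv (grad G y) (o - y).
Proof.
move=> G0 Gmon DR sG cy co.
pose up : 'rV[R]_n := \row_i Num.max (o 0 i - y 0 i) 0.
pose down : 'rV[R]_n := \row_i Num.max (y 0 i - o 0 i) 0.
have up0 : lev 0 up by move=> i; rewrite !mxE le_max lexx orbT.
have down0 : lev 0 down by move=> i; rewrite !mxE le_max lexx orbT.
have cup : cube (y + up).
  move=> i; have /andP[? ?] := cy i; have /andP[? ?] := co i.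
  by rewrite !mxE; case: (leP (o 0 i - y 0 i) 0) => ?; apply/andP; split; lra.
have cdown : cube (y - down).
  move=> i; have /andP[? ?] := cy i; have /andP[? ?] := co i.
  by rewrite !mxE; case: (leP (y 0 i - o 0 i) 0) => ?; apply/andP; split; lra.
have oup : lev o (y + up) by move=> i; rewrite !mxE; case: (leP (o 0 i - y 0 i) 0) => ?; lra.
have oy : o - y = up + - down.
  by apply/rowP => i; rewrite !mxE; case: leP => ?; case: leP => ?; lra.
rewrite oy dotvDr; move: oy => _.
have := DR_submodular_le_grad_up DR sG cy cup up0.
have := DR_submodular_le_grad_down DR sG cy cdown down0.
have := Gmon _ _ co cup oup; have := G0 _ cdown; lra.
Qed.

(** * Executions: a weakest-precondition calculus *)

Section WeakestPrecondition.
Context {R : realType} {n : nat} (O : oracles R n).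
Implicit Types (c : cmd R) (st : state R n) (Q : state R n -> nat -> nat -> Prop).

(** Total correctness for a nondeterministic language: Q may also bound the time
and the number of gradient calls. *)
Definition wp c st Q :=
  (exists st' t q, exec O c st st' t q) /\
  (forall st' t q, exec O c st st' t q -> Q st' t q).

Lemma wp_weaken c st Q Q' :
  wp c st Q -> (forall st' t q, Q st' t q -> Q' st' t q) -> wp c st Q'.
Proof. by move=> [ex all] QQ'; split=> // st' t q /all/QQ'. Qed.

Lemma wp_SetScal r e st Q :
  Q (set_scal st r (Defs.eval st e)) (1 + ecost e)%N 0%N -> wp (SetScal r e) st Q.
Proof.
move=> H; split; first by do 3 eexists; exact: exec_SetScal.
by move=> st' t q ex; inversion ex; subst.
Qed.

Lemma wp_SetCoord v i e st Q :
  Q (set_vec st v (write (vec st v) (idx st i) (Defs.eval st e))) (1 + ecost e)%N 0%N ->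
  wp (SetCoord v i e) st Q.
Proof.
move=> H; split; first by do 3 eexists; exact: exec_SetCoord.
by move=> st' t q ex; inversion ex; subst.
Qed.

Lemma wp_Seq c1 c2 st Q :
  wp c1 st (fun st1 t1 q1 =>
    wp c2 st1 (fun st2 t2 q2 => Q st2 (t1 + t2)%N (q1 + q2)%N)) ->
  wp (c1 ;; c2) st Q.
Proof.
move=> [[st1 [t1 [q1 ex1]]] all1]; split.
  have [[st2 [t2 [q2 ex2]]] _] := all1 _ _ _ ex1.
  by do 3 eexists; exact: exec_Seq ex1 ex2.
move=> st' t q ex; inversion ex; subst.
match goal with ex1 : exec O c1 _ _ _ _ |- _ =>
  by have [_] := all1 _ _ _ ex1; apply end.
Qed.

Lemma wp_IfLt e1 e2 c st Q :
  (Defs.eval st e1 < Defs.eval st e2 ->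
    wp c st (fun st' t q => Q st' (1 + ecost e1 + ecost e2 + t)%N q)) ->
  (Defs.eval st e2 <= Defs.eval st e1 -> Q st (1 + ecost e1 + ecost e2)%N 0%N) ->
  wp (IfLt e1 e2 c) st Q.
Proof.
move=> Ht Hf; split.
  case: (ltP (Defs.eval st e1) (Defs.eval st e2)) => [lt12|le21].
    have [[st1 [t1 [q1 ex1]]] _] := Ht lt12.
    by do 3 eexists; exact: exec_IfLt_true ex1.
  by do 3 eexists; exact: exec_IfLt_false.
move=> st' t q ex; inversion ex; subst; last exact: Hf.
by case: Ht => // _; apply.
Qed.

(** Uniform bounds T and q0 on one pass suffice for the cost of a loop; the
control of the loop adds one time unit per pass and one for the final test. *)
Lemma wp_For i a b c st (I : nat -> state R n -> Prop) T q0 : (a <= b)%N ->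
  I a st ->
  (forall k st1, (a <= k < b)%N -> I k st1 ->
    wp c (set_idx st1 i k)
      (fun st' t q => [/\ I k.+1 st', (t <= T)%N & (q <= q0)%N])) ->
  wp (For i a b c) st (fun st' t q =>
    [/\ I b st', (t <= 1 + (b - a) * (1 + T))%N & (q <= (b - a) * q0)%N]).
Proof.
move=> ab; move Ed : (b - a)%N => d.
elim: d a ab Ed st => [|d IH] a ab Ed st Ia step.
  have -> : b = a by lia.
  split; first by do 3 eexists; apply: exec_For_end.
  by move=> st' t q ex; inversion ex; subst; [split|lia].
have ltab : (a < b)%N by lia.
have [ex1 all1] := step a st ltac:(lia) Ia.
have rest st1 t1 q1 : exec O c (set_idx st i a) st1 t1 q1 ->
    wp (For i a.+1 b c) st1 (fun st' t q =>
      [/\ I b st', (t <= 1 + d * (1 + T))%N & (q <= d * q0)%N]).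
  move=> /all1[I1 _ _]; apply: IH => //; first by lia.
  by move=> k st2 hk; apply: step; lia.
split.
  case: ex1 => [st1 [t1 [q1 ex1]]].
  have [[st2 [t2 [q2 ex2]]] _] := rest _ _ _ ex1.
  by do 3 eexists; exact: exec_For_step ex1 ex2.
move=> st' t q ex; inversion ex; subst; first lia.
match goal with ex1 : exec O c _ _ _ _ |- _ =>
  have [_ ht1 hq1] := all1 _ _ _ ex1; have [_ all2] := rest _ _ _ ex1 end.
match goal with ex2 : exec O (For _ _ _ _) _ _ _ _ |- _ =>
  have [Ib ht2 hq2] := all2 _ _ _ ex2 end.
by split => //; rewrite mulSn; lia.
Qed.

Lemma wp_ValG v r st Q :
  Q (set_scal st r (valG O (vec st v))) 1%N 0%N -> wp (ValG R v r) st Q.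
Proof.
move=> H; split; first by do 3 eexists; exact: exec_ValG.
by move=> st' t q ex; inversion ex; subst.
Qed.

Lemma wp_ValC v r st Q :
  Q (set_scal st r (valC O (vec st v))) 1%N 0%N -> wp (ValC R v r) st Q.
Proof.
move=> H; split; first by do 3 eexists; exact: exec_ValC.
by move=> st' t q ex; inversion ex; subst.
Qed.

Lemma wp_GradG v w st Q :
  Q (set_vec st w (gradG O (vec st v))) 1%N 1%N -> wp (GradG R v w) st Q.
Proof.
move=> H; split; first by do 3 eexists; exact: exec_GradG.
by move=> st' t q ex; inversion ex; subst.
Qed.

Lemma wp_GradC v w st Q :
  Q (set_vec st w (gradC O (vec st v))) 1%N 1%N -> wp (GradC R v w) st Q.
Proof.
move=> H; split; first by do 3 eexists; exact: exec_GradC.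
by move=> st' t q ex; inversion ex; subst.
Qed.

Lemma wp_LinMax v w st Q : linmax O (vec st v) !=set0 ->
  (forall x, linmax O (vec st v) x ->
    Q (set_vec st w x) (1 + time_linmax O)%N 0%N) ->
  wp (LinMax R v w) st Q.
Proof.
move=> [x Ox] H; split; first by do 3 eexists; exact: exec_LinMax Ox.
by move=> st' t q ex; inversion ex; subst; exact: H.
Qed.

Lemma wp_MaxC w st Q : Defs.maxC O !=set0 ->
  (forall x, Defs.maxC O x -> Q (set_vec st w x) (1 + time_maxC O)%N 0%N) ->
  wp (MaxC R w) st Q.
Proof.
move=> [x Ox] H; split; first by do 3 eexists; exact: exec_MaxC Ox.
by move=> st' t q ex; inversion ex; subst; exact: H.
Qed.

Lemma read_ord (x : 'rV[R]_n) (j : 'I_n) : read x j = x 0 j.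
Proof. by rewrite /read valK. Qed.

(** The loops over coordinates perform vector operations.  When coordinate j is
written, coordinate j of every register, including the destination, still holds
its initial value; hence e may read the register being overwritten. *)
Lemma wp_coordinatewise i v e st (x : 'rV[R]_n) :
  (forall (j : 'I_n) st', scal st' = scal st -> idx st' i = j ->
    (forall w, vec st' w 0 j = vec st w 0 j) -> Defs.eval st' e = x 0 j) ->
  wp (For i 0 n (SetCoord v i e)) st (fun st' t q =>
    [/\ scal st' = scal st, vec st' = upd (vec st) v x,
        (t <= 1 + n * (2 + ecost e))%N & q = 0%N]).
Proof.
move=> ev; pose I k st' := scal st' = scal st /\ forall w (j : 'I_n),
  vec st' w 0 j = if (w == v) && (j < k)%N then x 0 j else vec st w 0 j.
apply: (wp_weaken (wp_For (I := I) (T := (1 + ecost e)%N) (q0 := 0) (leq0n n) _ _)).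
- by split=> // w j; rewrite ltn0 andbF.
- move=> k st1 /andP[_ kn] [sc1 vec1]; apply: wp_SetCoord; split=> //.
  split=> //= w j; rewrite /upd eqxx; have [->|wv] := eqVneq w v; last first.
    by rewrite vec1 (negbTE wv).
  rewrite mxE ltnS leq_eqVlt; have [jk|jk] := eqVneq (j : nat) k; last first.
    by rewrite vec1 eqxx.
  apply: ev => //=; first by rewrite /upd eqxx jk.
  by move=> w'; rewrite vec1 jk ltnn andbF.
- move=> st' t q [[sc' vec'] ht]; rewrite muln0 leqn0 => /eqP q0; split=> //.
    apply/funext => w; apply/rowP => j; rewrite vec' /upd ltn_ord andbT.
    by case: eqP => // ->.
  by move: ht; rewrite subn0 => /leq_trans; apply; rewrite addnA.
Qed.

(** * Executions: the pieces of the algorithm *)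

Lemma wp_eval_F st : wp (eval_F R) st (fun st' t q =>
  [/\ vec st' = vec st,
      scal st' r_F = valG O (vec st v_y) + valC O (vec st v_y),
      scal st' r_best = scal st r_best, t = 6%N & q = 0%N]).
Proof.
apply: wp_Seq; apply: wp_ValG; apply: wp_Seq; apply: wp_ValC.
by apply: wp_SetScal.
Qed.

Lemma wp_save_best st : wp (save_best R n) st (fun st' t q =>
  [/\ vec st' = upd (vec st) v_best (vec st v_y), scal st' r_best = scal st r_F,
      (t <= 3 + 3 * n)%N & q = 0%N]).
Proof.
apply: wp_Seq; apply: wp_SetScal.
apply: wp_weaken.
  apply: (wp_coordinatewise _ (x := vec st v_y)).
  by move=> j st' _ ij eqv; rewrite /= ij read_ord eqv.
by move=> st' t q [-> -> ht ->]; split=> //=; rewrite /= in ht; lia.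
Qed.

Definition FW_step (R : realType) (n : nat) (eps : R) : cmd R :=
  let eps2 := Mul (Const eps) (Const eps) in
  GradG R v_y v_g ;;
  GradC R v_y v_h ;;
  For i_coord 0 n
    (SetCoord v_w i_coord
       (Add (Coord R v_g i_coord)
            (Mul (Const 2) (Coord R v_h i_coord)))) ;;
  LinMax R v_w v_s ;;
  For i_coord 0 n
    (SetCoord v_y i_coord
       (Add (Mul (Defs.Sub (Const 1) eps2) (Coord R v_y i_coord))
            (Mul eps2 (Coord R v_s i_coord)))) ;;
  eval_F R ;;
  IfLt (Scal R r_best) (Scal R r_F) (save_best R n).

Lemma wp_FW_step eps st :
  (forall w, linmax O w !=set0) ->
  let y := vec st v_y in
  let F x := valG O x + valC O x in
  wp (FW_step n eps) st (fun st' t q =>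
    let y' := vec st' v_y in
    [/\ exists2 s, linmax O (gradG O y + 2 *: gradC O y) s &
          y' = (1 - eps ^+ 2) *: y + eps ^+ 2 *: s,
        if scal st r_best < F y'
        then vec st' v_best = y' /\ scal st' r_best = F y'
        else vec st' v_best = vec st v_best /\ scal st' r_best = scal st r_best,
        (t <= 17 + 25 * n + time_linmax O)%N & (q <= 2)%N]).
Proof.
move=> lin_ex y F.
apply: wp_Seq; apply: wp_GradG; apply: wp_Seq; apply: wp_GradC; apply: wp_Seq.
apply: wp_weaken.
  apply: (wp_coordinatewise _ (x := gradG O y + 2 *: gradC O y)).
  by move=> j st' _ ij eqv; rewrite /= ij !read_ord !eqv !mxE.
move=> st1 t1 q1 /= [sc1 vec1 ht1 ->].
apply: wp_Seq; apply: wp_LinMax => [|s]; first exact: lin_ex.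
rewrite vec1 /= => Os; apply: wp_Seq.
apply: wp_weaken.
  apply: (wp_coordinatewise _ (x := (1 - eps ^+ 2) *: y + eps ^+ 2 *: s)).
  by move=> j st' _ ij eqv; rewrite /= ij !read_ord !eqv !mxE /= vec1 -expr2.
move=> st2 t2 q2 /= [sc2 vec2 ht2 ->]; apply: wp_Seq.
apply: wp_weaken (wp_eval_F _) _ => st3 t3 q3 [vec3 F3 best3 -> ->].
have vy : vec st3 v_y = (1 - eps ^+ 2) *: y + eps ^+ 2 *: s by rewrite vec3 vec2.
have vb : vec st3 v_best = vec st v_best by rewrite vec3 vec2 /= vec1.
have sb : scal st3 r_best = scal st r_best by rewrite best3 sc2 sc1.
have {}F3 : scal st3 r_F = F (vec st3 v_y) by rewrite F3 vec3.
apply: wp_IfLt => /=; rewrite F3 sb => ltF.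
  apply: wp_weaken (wp_save_best _) _ => st4 t4 q4 [vec4 sc4 ht4 ->].
  rewrite vec4 /= ltF sc4 F3; split=> //; last by lia.
  by exists s.
rewrite ltNge ltF /=; split=> //; last by lia.
by exists s.
Qed.

End WeakestPrecondition.

(** * Progress of the iterates *)

(** In positive dimension the cube has two distinct points, on which a negative
Lipschitz constant is impossible. *)
Lemma smooth_constant_ge0 (R : realType) (n : nat) (L : R) (f : 'rV[R]_n -> R) :
  (0 < n)%N -> smooth L f -> 0 <= L.
Proof.
case: n f => // n f _ [_ lip].
have c0 : cube (0 : 'rV[R]_n.+1) by move=> i; rewrite mxE lexx ler01.
have c1 : cube (const_mx 1 : 'rV[R]_n.+1) by move=> i; rewrite mxE lexx ler01.
have := le_trans (norm2_ge0 _) (lip _ _ c1 c0); rewrite pmulr_lge0 // subr0.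
rewrite sqrtr_gt0 /dotv big_ord_recl !mxE mulr1 ltr_pwDl // sumr_ge0 // => i _.
by rewrite !mxE mulr1.
Qed.

Lemma convex_set_combination (R : realType) (n : nat) (P : set 'rV[R]_n) x y t :
  convex_set P -> P x -> P y -> 0 <= t <= 1 -> P ((1 - t) *: x + t *: y).
Proof.
move=> cP Px Py /andP[t0 t1]; have := cP y x (Itv01 t0 t1).
by rewrite !inE /conv /= /unstable.onem addrC => /(_ Py Px).
Qed.

Lemma compact_argmax (R : realType) (n : nat) (P : set 'rV[R]_n)
    (f : 'rV[R]_n -> R) :
  P !=set0 -> compact P -> {within P, continuous f} -> argmax P f !=set0.
Proof.
move=> P0 Pc fc; have [x xP xmax] := compact_EVT_max P0 Pc fc.
exists x; split=> [|z Pz]; first by rewrite inE in xP.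
by apply: xmax; rewrite inE.
Qed.

Section Progress.
Context {R : realType} {n : nat} (P : set 'rV[R]_n) (G C : 'rV[R]_n -> R).
Variables (L D : R) (o : 'rV[R]_n).
Hypotheses (n_gt0 : (0 < n)%N) (Pconv : convex_set P) (Pcube : P `<=` cube).
Hypotheses (G0 : nonnegative G) (Gmon : monotone_fun G) (Gsm : smooth L G).
Hypotheses (Gdr : DR_submodular G) (Csm : smooth L C) (Ccc : concave C).
Hypotheses (Po : P o) (normP : forall x, P x -> norm2 x <= D).
Let F x := G x + C x.
Let Phi x := G x + 2 * C x.

(** Coordinates in the cube are nonnegative, so <y, s> >= 0 and the cross term of
|s - y| ^ 2 can be dropped. *)
Lemma dist_sqr_le y s : P y -> P s -> dotv (s - y) (s - y) <= 2 * D ^+ 2.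
Proof.
move=> Py Ps; have sq x : P x -> dotv x x <= D ^+ 2.
  by move=> Px; rewrite -norm2_sqr ler_pXn2r ?nnegrE ?norm2_ge0 ?normP //;
     exact: le_trans (norm2_ge0 x) (normP Px).
have ys0 : 0 <= dotv y s.
  apply: sumr_ge0 => i _; apply: mulr_ge0.
    by case/andP: (Pcube Py i).
  by case/andP: (Pcube Ps i).
rewrite dotvBl !dotvBr (dotvC s y); have := sq _ Py; have := sq _ Ps.
lra.
Qed.

(** The error is 6 L D ^ 2 t ^ 2 because Phi is 3 L-smooth and |s - y| ^ 2 is at
most 2 D ^ 2. *)
Lemma FW_step_progress y s t : P y ->
  argmax P (dotv (grad G y + 2 *: grad C y)) s -> 0 <= t <= 1 ->
  t * (G o + 2 * C o - 2 * F y) - 6 * L * D ^+ 2 * t ^+ 2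
    <= Phi ((1 - t) *: y + t *: s) - Phi y.
Proof.
move=> Py [Ps smax] t01; set y' := _ + t *: s.
have Py' : P y' by exact: convex_set_combination.
have dE : y' - y = t *: (s - y).
  by apply/rowP => i; rewrite !mxE; ring.
have [cy cy' co] := And3 (Pcube Py) (Pcube Py') (Pcube Po).
have := smooth_lower_bound Gsm cy cy'; have := smooth_lower_bound Csm cy cy'.
rewrite dE !(dotvZr, dotvZl); have := dist_sqr_le Py Ps.
set dd := dotv (s - y) (s - y).
have := monotone_DR_submodular_grad G0 Gmon Gdr Gsm cy co.
have := concave_le_grad Csm Ccc cy co.
have := smax _ Po; rewrite !dotvDl !dotvZl !dotvBr.
have := smooth_constant_ge0 n_gt0 Gsm.
move: (dotv (grad G y) o) (dotv (grad G y) s) (dotv (grad G y) y)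
  (dotv (grad C y) o) (dotv (grad C y) s) (dotv (grad C y) y)
  => Go Gs Gy Co Cs Cy L0 best conc drs ddD smC smG.
have quad : t * (t * (L * dd)) <= t * (t * (L * (2 * D ^+ 2))).
  by case/andP: t01 => t0 _; rewrite !ler_wpM2l.
have lin : t * (G o + 2 * C o - 2 * F y) <= t * ((Gs - Gy) + 2 * (Cs - Cy)).
  case/andP: t01 => t0 _; apply: ler_wpM2l => //; rewrite /F; lra.
rewrite /Phi; lra.
Qed.

Variables (y0 : 'rV[R]_n) (t : R).
Hypotheses (t01 : 0 <= t <= 1).

(** The gain of each step is expressed through the best value F b found so far
rather than through the successive values F y.  As F b only increases, the bound
for earlier steps remains valid when b is replaced. *)
Definition FW_invariant (k : nat) (y b : 'rV[R]_n) : Prop :=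
  [/\ P y, P b, F y <= F b &
      k%:R * (t * (G o + 2 * C o - 2 * F b) - 6 * L * D ^+ 2 * t ^+ 2)
        <= Phi y - Phi y0].

Lemma FW_invariant_step k y b s : FW_invariant k y b ->
  argmax P (dotv (grad G y + 2 *: grad C y)) s ->
  let y' := (1 - t) *: y + t *: s in
  FW_invariant k.+1 y' (if F b < F y' then y' else b).
Proof.
move=> [Py Pb yb inv] smax y'.
have Py' : P y' by case: smax => Ps _; exact: convex_set_combination.
have prog := FW_step_progress Py smax t01; rewrite -/y' in prog.
set b' := if _ then _ else _.
have bb' : F b <= F b' by rewrite /b'; case: ltP => // /ltW.
split=> //; first by rewrite /b'; case: ifP.
  by rewrite /b'; case: (ltP (F b) (F y')).
have t0 : 0 <= t by case/andP: t01.
have tb : t * F b <= t * F b' by exact: ler_wpM2l.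
have ty : t * F y <= t * F b by exact: ler_wpM2l.
have ktb : k%:R * (t * F b) <= k%:R * (t * F b') by exact: ler_wpM2l.
rewrite -natr1 mulrDl mul1r; lra.
Qed.

(** Upper and lower bounds on Phi y - Phi y0 are compared after multiplication
by eps, which turns the factor N eps ^ 2 into 1.  The error comes out with
constant 3; 60 is chosen to agree with the constant of the running time. *)
Lemma FW_invariant_bound eta eps N y b :
  argmax P F o -> approx_argmax eta P C y0 -> 0 <= eta ->
  0 < eps < 1 -> t = eps ^+ 2 -> N%:R = eps ^- 3 ->
  FW_invariant N y b ->
  2^-1 * (1 - eps) * G o + C o - eps * (60 * (eta + L * D ^+ 2)) <= F b.
Proof.
move=> [_ omax] [Py0 C0] eta0 /andP[e0 e1] tE NE [Py Pb yb inv].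
have Phi_le : Phi y - Phi y0 <= G o + 2 * eta.
  have := omax _ Py; have := C0 _ Py; have := C0 _ Po; have := G0 (Pcube Py0).
  rewrite /Phi /F; lra.
have := ler_wpM2l (ltW e0) (le_trans inv Phi_le).
have L0 := smooth_constant_ge0 n_gt0 Gsm.
rewrite [X in X <= _](_ : _ =
  G o + 2 * C o - 2 * F b - 6 * (L * D ^+ 2) * eps ^+ 2); last first.
  by rewrite NE tE; field; rewrite gt_eqF.
have LD0 : 0 <= L * D ^+ 2 by rewrite mulr_ge0 ?sqr_ge0.
set M := L * D ^+ 2 in LD0 *.
have : M * eps ^+ 2 <= M * eps.
  by rewrite ler_wpM2l // expr2 ler_piMl ?ltW.
have : 0 <= M * eps by rewrite mulr_ge0 // ltW.
have : 0 <= eps * eta by rewrite mulr_ge0 // ltW.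
lra.
Qed.
End Progress.

(** * The algorithm *)

Theorem theorem3p10 (R : realType) :
  exists K : R, 0 < K /\
  forall (n : nat) (P : set 'rV[R]_n) (G C : 'rV[R]_n -> R)
    (L eta eps D : R) (o : 'rV[R]_n) (S1 S2 : nat),
    let F := fun x => G x + C x in
    (0 < n)%N ->
    convex_body P -> P `<=` cube ->
    nonnegative G -> monotone_fun G -> smooth L G -> DR_submodular G ->
    smooth L C -> concave C ->
    argmax P F o ->
    (exists2 x, argmax P (@norm2 R n) x & D = norm2 x) ->
    0 <= eta ->
    0 < eps < 1 -> eps ^- 3 \is a Num.int ->
    forall st0 : state R n,
    let run := exec (oracles_of P G C eta S1 S2)
                    (gradient_combining_FW n eps) st0 in
    (exists st t q, run st t q) /\
    (forall st t q, run st t q ->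
      [/\ t%:R <= K * (eps ^- 3 * (n%:R + S1%:R) + S2%:R),
          q%:R <= K * eps ^- 3 &
          F (output st) >=
            2^-1 * (1 - eps) * G o + C o
              - eps * (K * (eta + L * D ^+ 2))]).
Proof.
(* The time is at most S2 + 11 + 3 n + N (18 + 25 n + S1), where N = eps ^ -3;
   as n and N are positive, this is at most S2 + 57 N (n + S1). *)
exists 60; split=> // n P G C L eta eps D o S1 S2 F n0 [P0 Pc Pconv] PQ G0 Gmon
  Gsm Gdr Csm Ccc omax [xD [PxD xDmax] DE] eta0 e01 eint st0 run.
have [e0 e1] := andP e01.
pose N := Num.truncn (eps ^- 3).
have NE : N%:R = eps ^- 3.
  by rewrite truncnK // natrEint eint invr_ge0 exprn_ge0 // ltW.
have N0 : (0 < N)%N by rewrite -(ltr_nat R) NE invr_gt0 exprn_gt0.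
have normP x : P x -> norm2 x <= D by rewrite DE => /xDmax.
have Po : P o by case: omax.
have t01 : 0 <= eps ^+ 2 <= 1 by rewrite sqr_ge0 expr_le1 ?ltW.
pose O := oracles_of P G C eta S1 S2.
have lin_ex w : linmax O w !=set0.
  apply: compact_argmax => //; apply: continuous_subspaceT.
  exact: dotv_continuous.
have max_ex : Defs.maxC O !=set0.
  have [x [Px xmax]] := compact_argmax P0 Pc (smooth_within_continuous Csm PQ).
  by exists x; split=> // z /xmax; rewrite lerBlDr => /le_trans; apply; rewrite lerDl.
apply: (@wp_weaken _ _ O _ _ (fun st t q => [/\ (t <= 60 * (N * (n + S1) + S2))%N,
  (q <= 60 * N)%N & 2^-1 * (1 - eps) * G o + C o
     - eps * (60 * (eta + L * D ^+ 2)) <= F (output st)])); last first.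
  move=> st t q [ht hq hF]; split=> //.
    by rewrite -NE -!(natrD, natrM) ler_nat.
  by rewrite -NE -natrM ler_nat.
apply: wp_Seq; apply: wp_MaxC => // y0 y0max; apply: wp_Seq.
apply: wp_weaken (wp_eval_F _ _) _ => st1 t1 q1 [vec1 F1 _ -> ->].
apply: wp_Seq; apply: wp_weaken (wp_save_best _ _) _ => st2 t2 q2 [vec2 best2 ht2 ->].
(* The loop counter starts at 1: at the beginning of pass k, k - 1 steps have
   been made. *)
pose inv k (st : state R n) :=
  FW_invariant P G C L D o y0 (eps ^+ 2) k.-1 (vec st v_y) (vec st v_best) /\
  scal st r_best = F (vec st v_best).
apply: wp_weaken.
  apply: (@wp_For _ _ O i_iter 1 N.+1 (FW_step n eps) st2 inv
    (17 + 25 * n + S1) 2) => //.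
    rewrite /inv vec2 best2 F1 vec1 /=; split=> //.
    by case: y0max => Py0 _; split=> //; rewrite mul0r subrr.
  move=> [|k] st k_range [invk bestk]; first by lia.
  apply: wp_weaken (wp_FW_step _ _ lin_ex) _.
  move=> st' t q /= [[s smax y'E] bestE ht hq]; split=> //.
  have := FW_invariant_step n0 Pconv PQ G0 Gmon Gsm Gdr Csm Ccc Po normP t01 invk smax.
  rewrite /= -y'E; move: bestE; rewrite bestk /inv /F.
  by case: ifP => _ [-> ->].
move=> st t q [[invN _] ht hq].
split.
- move: ht; rewrite /= in ht2 *. nia.
- by rewrite /=; lia.
exact: (FW_invariant_bound n0 PQ G0 Gsm Po omax y0max eta0 e01 erefl NE invN).
Qed.
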